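(* Let $m\ge 2$ be an integer. The group $\mathrm{Aut}^*(R_m)$ splits over its normal subgroup $\mathrm{Aut}(R_m)$ (that is, there is a subgroup $K\le \mathrm{Aut}^*(R_m)$ with $K\cap \mathrm{Aut}(R_m)=1$ and $K\cdot\mathrm{Aut}(R_m)=\mathrm{Aut}^*(R_m)$) if and only if $m$ is odd.
   Context: Fix an integer $m\ge 2$. An $m$-edge-coloured complete graph is a complete graph each of whose edges is assigned one of the colours $1,\dots,m$. $R_m$ denotes the unique (up to isomorphism) countable $m$-edge-coloured complete graph which is universal (every finite or countable $m$-edge-coloured complete graph embeds in it, colour-preservingly) and homogeneous (every colour-preserving isomorphism between finite induced subgraphs extends to a colour-preserving automorphism of $R_m$). $\mathrm{Aut}(R_m)$ is the group of permutations of the vertex set of $R_m$ preserving the colour of every edge. $\mathrm{Aut}^*(R_m)$ is the group of permutations $g$ of the vertex set of $R_m$ which induce a permutation of the colours, i.e. for which there is a permutation $\pi$ of $\{1,\dots,m\}$ such that for all edges $\{u,v\}$, the colour of $\{u^g,v^g\}$ is $\pi$ applied to the colour of $\{u,v\}$. $\mathrm{Aut}(R_m)$ is a normal subgroup of $\mathrm{Aut}^*(R_m)$, and the induced action on colours gives $\mathrm{Aut}^*(R_m)/\mathrm{Aut}(R_m)\cong \mathrm{Sym}(m)$. *)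

(* Defs.v *)
Set Warnings "-notation-incompatible-prefix,-notation-overridden,-redundant-canonical-projection".
From HB Require Import structures.
From mathcomp Require Import all_boot all_fingroup finmap.
From mathcomp Require Import boolp classical_sets.

Set Implicit Arguments.
Unset Strict Implicit.
Unset Printing Implicit Defensive.

Local Open Scope classical_set_scope.
Local Open Scope group_scope.

(* The edge {u, v}, u != v, has colour col u v. The values col u u carry no
   meaning: every notion below only inspects pairs of distinct vertices. *)
Record ecgraph (m : nat) (V : Type) := ECGraph {
  col :> V -> V -> 'I_m;
  col_sym : forall u v, col u v = col v u
}.

Definition induced (m : nat) (V : choiceType) (G : ecgraph m V) (A : {fset V}) :
    ecgraph m A :=
  @ECGraph m A (fun x y => G (val x) (val y))
    (fun x y => col_sym G (val x) (val y)).

Definition preserves_colours (m : nat) (V W : Type)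
    (G : ecgraph m V) (H : ecgraph m W) (f : V -> W) : Prop :=
  forall u v, u <> v -> H (f u) (f v) = G u v.

Definition is_embedding (m : nat) (V W : Type)
    (G : ecgraph m V) (H : ecgraph m W) (f : V -> W) : Prop :=
  injective f /\ preserves_colours G H f.

Definition is_isomorphism (m : nat) (V W : Type)
    (G : ecgraph m V) (H : ecgraph m W) (f : V -> W) : Prop :=
  bijective f /\ preserves_colours G H f.

Record vperm (V : Type) := VPerm {
  vfun :> V -> V;
  vinv : V -> V;
  vfunK : cancel vfun vinv;
  vinvK : cancel vinv vfun
}.

Lemma vperm_eq (V : Type) (g h : vperm V) : vfun g =1 vfun h -> g = h.
Proof.
case: g h => [f f' fK f'K] [h h' hK h'K] /= /funext fh; subst h.
have e : f' = h' by apply/funext => x; rewrite -{1}(h'K x) fK.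
by subst h'; congr VPerm; exact: Prop_irrelevance.
Qed.

Section VPermGroup.
Variable V : Type.
Implicit Types g h k : vperm V.

HB.instance Definition _ := gen_eqMixin (vperm V).
HB.instance Definition _ := gen_choiceMixin (vperm V).

Definition vperm_one : vperm V :=
  @VPerm V id id (fun=> erefl) (fun=> erefl).

Definition vperm_inv g : vperm V := VPerm (@vinvK V g) (@vfunK V g).

(* Permutations act on the right: g * h is g followed by h, as for {perm T}. *)
Definition vperm_mul g h : vperm V :=
  @VPerm V (h \o g) (vinv g \o vinv h)
    (can_comp (@vfunK V h) (@vfunK V g)) (can_comp (@vinvK V g) (@vinvK V h)).

Let mulA : associative vperm_mul.
Proof. by move=> g h k; apply: vperm_eq. Qed.
Let mul1 : left_id vperm_one vperm_mul.
Proof. by move=> g; apply: vperm_eq. Qed.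
Let mulg1' : right_id vperm_one vperm_mul.
Proof. by move=> g; apply: vperm_eq. Qed.
Let mulVg' : left_inverse vperm_one vperm_inv vperm_mul.
Proof. by move=> g; apply: vperm_eq => x /=; rewrite vinvK. Qed.
Let mulgV' : right_inverse vperm_one vperm_inv vperm_mul.
Proof. by move=> g; apply: vperm_eq => x /=; rewrite vfunK. Qed.

HB.instance Definition _ :=
  isGroup.Build (vperm V) mulA mul1 mulg1' mulVg' mulgV'.

End VPermGroup.

Definition Aut (m : nat) (V : Type) (G : ecgraph m V) : set (vperm V) :=
  [set g | preserves_colours G G g].

Definition AutStar (m : nat) (V : Type) (G : ecgraph m V) : set (vperm V) :=
  [set g | exists p : 'S_m,
     forall u v, u <> v -> G (g u) (g v) = p (G u v)].

(* A countType is either finite or countably infinite. *)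
Definition universal (m : nat) (V : countType) (R : ecgraph m V) : Prop :=
  forall (W : countType) (G : ecgraph m W),
    exists f : W -> V, is_embedding G R f.

Definition homogeneous (m : nat) (V : countType) (R : ecgraph m V) : Prop :=
  forall (A B : {fset V}) (f : A -> B),
    is_isomorphism (induced R A) (induced R B) f ->
    exists2 g, g \in Aut R & forall x : A, g (val x) = val (f x).

Definition splits_over (gT : groupType) (G N : set gT) : Prop :=
  exists K : set gT,
    [/\ group_closed (mem K),
        K `<=` G,
        K `&` N = [set 1] &
        [set k * n | k in K & n in N] = G].

Section AutGroups.
Variables (m : nat) (V : Type) (G : ecgraph m V).

Let vfun_neq (g : vperm V) u v : u <> v -> g u <> g v.
Proof. by move=> uv /(can_inj (@vfunK V g)). Qed.

Let vinv_neq (g : vperm V) u v : u <> v -> vinv g u <> vinv g v.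
Proof. by move=> uv /(can_inj (@vinvK V g)). Qed.

Lemma Aut_group_closed : group_closed (mem (Aut G)).
Proof.
split=> [|g h]; first by rewrite inE.
rewrite !inE => gA hA u v uv /=.
rewrite -(gA u v) // -(hA (vinv h (g u))) ?vinvK //.
by apply: vinv_neq; apply: vfun_neq.
Qed.

Lemma AutStar_group_closed : group_closed (mem (AutStar G)).
Proof.
split=> [|g h]; first by rewrite inE; exists 1 => u v _; rewrite perm1.
rewrite !inE => -[p gp] [q hq]; exists (p * q^-1) => u v uv /=.
rewrite permM -gp //; apply: (canRL (permK q)).
by rewrite -hq ?vinvK //; apply: vinv_neq; apply: vfun_neq.
Qed.

Lemma Aut_sub_AutStar : Aut G `<=` AutStar G.
Proof. by move=> g gA; exists 1 => u v uv; rewrite perm1 gA. Qed.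

Lemma Aut_normal (g h : vperm V) :
  g \in Aut G -> h \in AutStar G -> g ^ h \in Aut G.
Proof.
rewrite !inE => gA [p hp] u v uv.
have uv' := vinv_neq (g := h) uv.
by rewrite /= hp ?gA -?hp ?vinvK //; apply: vfun_neq.
Qed.

End AutGroups.

(* Main.v *)
(** If [m] is even, a complement would contain an involution [k] inducing the
    fixed-point-free colour involution [i |-> m - 1 - i].  Whenever [k] moves
    [v], it fixes the edge [{v, k v}] and hence its colour; so [k] is the
    identity, which is absurd.  If [m] is odd, let ['S_m] act semiregularly on
    [nat * 'S_m] by right translation.  The stabiliser of an edge has order at
    most 2, and an involution of an odd set of colours fixes a colour, so every
    orbit of edges can be coloured equivariantly; the colours between different
    translates are otherwise free and can be chosen so that the extension
    property holds.  By back-and-forth the resulting graph is isomorphic to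
    [R], and carries a copy of ['S_m] that is a complement. *)
Set Warnings "-notation-incompatible-prefix,-notation-overridden".
From mathcomp Require Import finmap.
From mathcomp Require Import all_boot all_fingroup all_solvable.
From mathcomp Require Import boolp classical_sets.
Require Import Defs.

Set Implicit Arguments.
Unset Strict Implicit.
Unset Printing Implicit Defensive.

Local Open Scope group_scope.

(** * The extension property of a universal homogeneous graph *)

Definition extension_property (m : nat) (V : eqType) (G : ecgraph m V) : Prop :=
  forall (s : seq V) (c : V -> 'I_m),
    exists2 z, z \notin s & {in s, forall a, G z a = c a}.

Definition one_point_col (m : nat) (V : choiceType) (R : ecgraph m V)
    (A : {fset V}) (c : V -> 'I_m) (x0 : 'I_m) (x y : option A) : 'I_m :=
  match x, y with
  | Some a, Some b => R (val a) (val b)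
  | Some a, None | None, Some a => c (val a)
  | None, None => x0
  end.

Lemma one_point_col_sym (m : nat) (V : choiceType) (R : ecgraph m V)
    (A : {fset V}) (c : V -> 'I_m) (x0 : 'I_m) (x y : option A) :
  one_point_col R c x0 x y = one_point_col R c x0 y x.
Proof. by case: x y => [a|] [b|] //=; apply: col_sym. Qed.

(** Universality embeds the one-point extension of [A] prescribed by [c]. Homogeneity carries [A]
    onto its image by an automorphism, and the preimage of the new point is the vertex sought. *)
Lemma universal_homogeneous_extension (m : nat) (V : countType)
    (R : ecgraph m V) (x0 : 'I_m) :
  universal R -> homogeneous R -> extension_property R.
Proof.
move=> univ hom s c.
pose A := [fset x in s]%fset.
have [f [f_inj f_col]] := univ (option A) (ECGraph (@one_point_col_sym m V R A c x0)).
pose fA (a : A) := f (Some a).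
have fA_inj : injective fA by move=> a b /f_inj [].
pose B := [fset fA a | a in {: A}]%fset.
have fB (a : A) : fA a \in B by apply: in_imfset.
pose h (a : A) : B := [` fB a]%fset.
have h_inj : injective h by move=> a b /(congr1 val) /fA_inj.
have h_bij : bijective h.
  apply: inj_card_bij => //.
  by rewrite -cardfE (card_imfset _ _ fA_inj) cardE.
have [|g] := hom A B h.
  split=> // a b ab /=; rewrite f_col //= => -[]; exact: ab.
rewrite inE => gA gh.
have Dg a (aA : a \in A) : g a = f (Some [` aA]%fset) by rewrite (gh [` aA]%fset).
have zA : vinv g (f None) \notin A.
  by apply/negP => zA; have := Dg _ zA; rewrite vinvK => /f_inj.
exists (vinv g (f None)); first by move: zA; rewrite !inE.
move=> a sa; have aA : a \in A by rewrite !inE.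
rewrite -gA; last by move=> za; rewrite za aA in zA.
by rewrite vinvK (Dg _ aA) f_col.
Qed.

(** * Back-and-forth between countable graphs with the extension property *)

Definition partial_iso (m : nat) (V W : eqType) (G : ecgraph m V)
    (H : ecgraph m W) (l : seq (V * W)) : Prop :=
  {in l &, forall p q, (p.1 = q.1 <-> p.2 = q.2) /\
                       (p.1 <> q.1 -> H p.2 q.2 = G p.1 q.1)}.

Definition swap_pair (V W : Type) (p : V * W) : W * V := (p.2, p.1).

Lemma partial_iso_swap (m : nat) (V W : eqType) (G : ecgraph m V)
    (H : ecgraph m W) (l : seq (V * W)) :
  partial_iso G H l -> partial_iso H G (map (@swap_pair V W) l).
Proof.
move=> iso _ _ /mapP[p pl ->] /mapP[q ql ->] /=.
have [eq12 colE] := iso p q pl ql; split; first exact: iff_sym.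
by move=> /= ne; rewrite colE // => /eq12.
Qed.

Lemma partial_iso_forth (m : nat) (V W : eqType) (G : ecgraph m V)
    (H : ecgraph m W) (l : seq (V * W)) (v : V) :
  extension_property H -> partial_iso G H l ->
  exists l', [/\ partial_iso G H l', {subset l <= l'} &
                 exists w, (v, w) \in l'].
Proof.
move=> extH iso.
case: (pselect (exists w, (v, w) \in l)) => [vl|vl]; first by exists l; split.
(* [c] transports the colours at [v] along [l]. It is well defined because [l] is injective; off the
   range of [l] its value is arbitrary. *)
have [c cE] : exists c : W -> 'I_m,
    forall w, forall p, p \in l -> p.2 = w -> c w = G v p.1.
  suff /choice[c cE] : forall w, exists k, forall p, p \in l -> p.2 = w -> k = G v p.1.
    by exists c.
  move=> w; case: (pselect (exists2 p, p \in l & p.2 = w)) => [[p pl pw]|no].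
    exists (G v p.1) => q ql qw; congr (G v _).
    by apply: (iso p q pl ql).1.2; rewrite pw qw.
  by exists (G v v) => p pl pw; case: no; exists p.
have [w wl wc] := extH (unzip2 l) c.
have new p : p \in l -> [/\ p.1 <> v, p.2 <> w & H w p.2 = G v p.1].
  case: p => x y xy; have yl : y \in unzip2 l by apply/mapP; exists (x, y).
  split=> /= [xv|yw|]; first by case: vl; exists y; rewrite -xv.
    by rewrite -yw yl in wl.
  by rewrite wc // (cE y (x, y)).
exists ((v, w) :: l); split; last by exists w; rewrite mem_head.
  move=> p q; rewrite !inE => /predU1P[->|pl] /predU1P[->|ql] //=.
  - by have [? ? ->] := new q ql; split=> //; split=> /esym.
  - by have [? ? e] := new p pl; rewrite col_sym e col_sym; split=> //; split.
  - exact: iso.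
by move=> p pl; rewrite inE pl orbT.
Qed.

Lemma partial_iso_back (m : nat) (V W : eqType) (G : ecgraph m V)
    (H : ecgraph m W) (l : seq (V * W)) (w : W) :
  extension_property G -> partial_iso G H l ->
  exists l', [/\ partial_iso G H l', {subset l <= l'} &
                 exists v, (v, w) \in l'].
Proof.
move=> extG iso.
have [l' [iso' sub [v vw]]] := partial_iso_forth w extG (partial_iso_swap iso).
exists (map (@swap_pair W V) l'); split; first exact: partial_iso_swap.
  by move=> [x y] xy; apply/mapP; exists (y, x) => //; apply/sub/mapP; exists (x, y).
by exists v; apply/mapP; exists (w, v).
Qed.

Lemma back_and_forth (m : nat) (V W : countType) (G : ecgraph m V)
    (H : ecgraph m W) :
  extension_property G -> extension_property H ->
  exists f : V -> W, is_isomorphism G H f.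
Proof.
move=> extG extH.
(* The hypothesis on [nl.2] stands under the existential so that choice yields a total step
   function. Stage [n] treats the vertices with code [n] on both sides. *)
have step_ex (nl : nat * seq (V * W)) : exists l', partial_iso G H nl.2 ->
    [/\ partial_iso G H l', {subset nl.2 <= l'},
        forall v, unpickle nl.1 = Some v -> exists w, (v, w) \in l' &
        forall w, unpickle nl.1 = Some w -> exists v, (v, w) \in l'].
  case: nl => n l /=.
  case: (pselect (partial_iso G H l)) => [iso|]; last by exists l.
  have [l1 [iso1 sub1 in1]] : exists l1, [/\ partial_iso G H l1,
      {subset l <= l1} &
      forall v, unpickle n = Some v -> exists w, (v, w) \in l1].
    case: (unpickle n) => [v|]; last by exists l; split.
    have [l1 [? ? ?]] := partial_iso_forth v extH iso.
    by exists l1; split=> // _ [<-].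
  have [l2 [iso2 sub2 in2]] : exists l2, [/\ partial_iso G H l2,
      {subset l1 <= l2} &
      forall w, unpickle n = Some w -> exists v, (v, w) \in l2].
    case: (unpickle n) => [w|]; last by exists l1; split.
    have [l2 [? ? ?]] := partial_iso_back w extG iso1.
    by exists l2; split=> // _ [<-].
  exists l2 => _; split=> // [p /sub1/sub2 //|v /in1 [w /sub2 vw]].
  by exists w.
have [step stepP] := choice step_ex.
pose L := fix L n := if n is n'.+1 then step (n', L n') else [::].
have L_iso n : partial_iso G H (L n).
  by elim: n => [|n IHn]; [case|have [] := stepP (n, L n) IHn].
have L_sub i j : i <= j -> {subset L i <= L j}.
  move=> /subnK <-; elim: (j - i)%N => //= k IHk p /IHk.
  by have [_ sub _ _] := stepP ((k + i)%N, _) (L_iso (k + i)%N); apply: sub.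
have L_iso2 n1 n2 p q : p \in L n1 -> q \in L n2 ->
    (p.1 = q.1 <-> p.2 = q.2) /\ (p.1 <> q.1 -> H p.2 q.2 = G p.1 q.1).
  move=> /(L_sub _ _ (leq_maxl n1 n2)) pl /(L_sub _ _ (leq_maxr n1 n2)) ql.
  exact: L_iso pl ql.
have L_fst v : exists w, exists n, (v, w) \in L n.
  have [_ _ /(_ v (pickleK v)) [w vw] _] := stepP (pickle v, _) (L_iso (pickle v)).
  by exists w, (pickle v).+1.
have L_snd w : exists v, exists n, (v, w) \in L n.
  have [_ _ _ /(_ w (pickleK w)) [v vw]] := stepP (pickle w, _) (L_iso (pickle w)).
  by exists v, (pickle w).+1.
have [f fP] := choice L_fst; have [g gP] := choice L_snd.
exists f; split.
  exists g => [v|w].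
    have [n1 p1] := fP v; have [n2 p2] := gP (f v).
    exact: (L_iso2 _ _ _ _ p2 p1).1.2.
  have [n1 p1] := fP (g w); have [n2 p2] := gP w.
  exact: (L_iso2 _ _ _ _ p1 p2).1.1.
move=> u v uv; have [n1 p1] := fP u; have [n2 p2] := fP v.
exact: (L_iso2 _ _ _ _ p1 p2).2.
Qed.

(** * Lifting colour permutations, and the even case *)

Definition recolour (m : nat) (V : Type) (p : 'S_m) (G : ecgraph m V) :
    ecgraph m V :=
  @ECGraph m V (fun u v => p (G u v)) (fun u v => congr1 p (col_sym G u v)).

Lemma recolour_extension (m : nat) (V : eqType) (p : 'S_m) (G : ecgraph m V) :
  extension_property G -> extension_property (recolour p G).
Proof.
move=> ext s c; have [z zs zc] := ext s (fun v => p^-1 (c v)).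
by exists z => // a /zc /= ->; rewrite permKV.
Qed.

(** Recolouring by [p] keeps the extension property, so back-and-forth gives an isomorphism from the
    recoloured graph to [G]. *)
Lemma AutStar_lift (m : nat) (V : countType) (G : ecgraph m V) (p : 'S_m) :
  extension_property G ->
  exists g : vperm V, forall u v, u <> v -> G (g u) (g v) = p (G u v).
Proof.
move=> ext.
have [f [[g fK gK] fcol]] := back_and_forth (recolour_extension p ext) ext.
by exists (VPerm fK gK) => u v /fcol.
Qed.

Lemma edge_of_colour (m : nat) (V : eqType) (G : ecgraph m V) (i : 'I_m) :
  extension_property G -> exists u v, u <> v /\ G u v = i.
Proof.
move=> ext; have [v _ _] := ext [::] (fun=> i).
have [u uv uc] := ext [:: v] (fun=> i).
by exists u, v; split; [apply/eqP; rewrite inE in uv|apply: uc; rewrite inE].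
Qed.

Lemma even_not_split (m : nat) (V : countType) (R : ecgraph m V) (x0 : 'I_m) :
  extension_property R -> ~~ odd m -> ~ splits_over (AutStar R) (Aut R).
Proof.
move=> ext m_even [K [[_ K_closed] KsubA KI KM]].
pose p : 'S_m := perm (@rev_ord_inj m).
(* A fixed colour [i] would give [m = 2 * i + 1]. *)
have p_free i : p i <> i.
  rewrite permE => /(congr1 val) /= e; move: m_even.
  by rewrite -(subnK (ltn_ord i)) e addnS addnn /= odd_double.
have pp i : p (p i) = i by rewrite !permE rev_ordK.
have [g gp] := AutStar_lift p ext.
have : AutStar R g by exists p.
(* The factor [n] preserves colours, so the factor [k] in [K] induces [p] just as [g] does. *)
rewrite -KM => -[k Kk [n]]; rewrite /Aut /= => nA kn.
have kp u v : u <> v -> R (k u) (k v) = p (R u v).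
  move=> uv; rewrite -gp // -kn /= nA // => /(can_inj (@vfunK V k)); exact: uv.
have k2 : k * k = 1.
  suff : (K `&` Aut R)%classic (k * k) by rewrite KI /=.
  split.
    (* [K_closed] gives closure under [g * h^-1], so [k * k] is read as [k * (k^-1)^-1]. *)
    have [K1 _] : (K `&` Aut R)%classic 1 by rewrite KI /=.
    have kVK : 1 * k^-1 \in K by apply: K_closed; apply/mem_set.
    rewrite -[X in _ * X]invgK; apply/set_mem; apply: K_closed.
      exact/mem_set.
    by rewrite -[k^-1]mul1g.
  by move=> u v uv /=; rewrite !kp ?pp // => /(can_inj (@vfunK V k)).
have kk v : k (k v) = v by have /(congr1 (fun h : vperm V => h v)) := k2.
have k1 v : k v = v.
  apply: contrapT => kv; apply: (p_free (R (k v) v)).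
  by rewrite -kp // kk col_sym.
have [u [v [uv _]]] := edge_of_colour x0 ext.
by apply: (p_free (R u v)); rewrite -kp // !k1.
Qed.

(** * Equivariant colouring of a regular orbit for odd [m] *)

(** The group generated by [d] is a 2-group, so its number of fixed points is congruent to [m]
    modulo 2. *)
Lemma involution_fixpoint (m : nat) (d : 'S_m) :
  odd m -> d^-1 = d -> exists i, d i = i.
Proof.
move=> m_odd dV.
have d2 : 2.-group <[d]>.
  rewrite /pgroup -orderE; apply: (@pnat_dvd _ 2) => //.
  by rewrite order_dvdn expgS expg1 -{1}dV mulVg.
have := pgroup_fix_mod d2 (S := [set: 'I_m]) (to := 'P%act).
have acts : [acts <[d]>, on [set: 'I_m] | 'P%act].
  by apply/actsP => a _ x; rewrite !inE.
move/(_ acts); rewrite cardsT card_ord => e.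
have /card_gt0P [i] : 0 < #|'Fix_([set: 'I_m] | 'P)(<[d]>)|.
  by rewrite lt0n; apply/eqP => e0; move: e; rewrite e0 mod0n modn2 m_odd.
by rewrite inE => /andP[_ /afixP/(_ d (cycle_id d)) ?]; exists i.
Qed.

(* Equivariant colourings of the edges inside one regular orbit: the edge
   [{g, h}] receives the colour [g (f (h * g^-1))]. *)
Lemma symmetric_connection (m : nat) :
  odd m -> exists f : 'S_m -> 'I_m, forall d : 'S_m, d (f d^-1) = f d.
Proof.
move=> m_odd.
have fix_ex (d : 'S_m) : exists i, d^-1 = d -> d i = i.
  case: (pselect (d^-1 = d)) => [dV|]; last by exists (Ordinal (odd_gt0 m_odd)).
  by have [i di] := involution_fixpoint m_odd dV; exists i.
have [fx fxP] := choice fix_ex; pose x0 := fx 1.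
(* The equation for [d = d^-1] demands a colour fixed by [d]. In any other pair of inverses, the
   element of smaller rank gets [x0], which forces the value at the other. *)
exists (fun d => if d^-1 == d then fx d else
  if enum_rank d < enum_rank d^-1 then x0 else d x0) => d.
rewrite invgK (eq_sym d) ; case: (eqVneq d^-1 d) => [dV|dV].
  by rewrite dV fxP.
case: ltngtP => [||/ord_inj/enum_rank_inj e]; rewrite ?permKV //.
by rewrite e eqxx in dV.
Qed.

(** * A model with the extension property on which the symmetric group acts by translation *)

Section Model.

Context (m : nat) (x0 : 'I_m) (f : 'S_m -> 'I_m).
Hypothesis f_sym : forall d : 'S_m, d (f d^-1) = f d.

Local Notation vertex := (nat * 'S_m)%type.

(* The 2-adic valuation takes each value at arbitrarily large [n], so every
   finite pattern is coded by some [n] above any given bound. *)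
Definition pattern (n : nat) (x : vertex) : 'I_m :=
  if unpickle (logn 2 n) is Some l then
    nth x0 (@unzip2 vertex 'I_m l) (index x (unzip1 l))
  else x0.

Lemma patternP (s : seq vertex) (c : vertex -> 'I_m) (N : nat) :
  exists2 n, N < n & {in s, pattern n =1 c}.
Proof.
pose l := [seq (a, c a) | a <- s].
(* The factor [3 ^ N] exceeds [N] and leaves the 2-adic valuation alone. *)
exists (2 ^ pickle l * 3 ^ N)%N.
  by apply: leq_trans (ltn_expl N (isT : 1 < 3)) _; rewrite leq_pmull ?expn_gt0.
have log_n : logn 2 (2 ^ pickle l * 3 ^ N) = pickle l.
  by rewrite lognM ?expn_gt0 // !lognX muln1 muln0 addn0.
move=> a sa; rewrite /pattern log_n pickleK.
rewrite /unzip1 /unzip2 -!map_comp map_id_in //= (nth_map a) ?index_mem //=.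
by rewrite nth_index.
Qed.

(** Equivariance dictates the form: the vertex of higher level is translated to second component
    [1], the colour is read off there, and the translation is undone on colours. *)
Definition model_col (x y : vertex) : 'I_m :=
  let: (n, g) := x in let: (j, h) := y in
  if j < n then g (pattern n (j, h * g^-1))
  else if n < j then h (pattern j (n, g * h^-1))
  else g (f (h * g^-1)).

Lemma model_col_sym (x y : vertex) : model_col x y = model_col y x.
Proof.
case: x y => n g [j h] /=; case: ltngtP => // _.
by rewrite -f_sym invMg invgK -permM mulgKV.
Qed.

Definition model : ecgraph m vertex := ECGraph model_col_sym.

Definition translate (p : 'S_m) (x : vertex) : vertex := (x.1, x.2 * p).

Lemma model_translate (p : 'S_m) (x y : vertex) :
  model (translate p x) (translate p y) = p (model x y).
Proof.
case: x y => n g [j h] /=; rewrite !invMg !mulgA !mulgK.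
by do 2?case: ifP => _; rewrite permM.
Qed.

Lemma model_extension : extension_property model.
Proof.
move=> s c; have [n n_gt nP] := patternP s c (\max_(x <- s) x.1).
have lt_n a : a \in s -> a.1 < n.
  by move=> sa; apply: leq_ltn_trans n_gt; apply: (@leq_bigmax_seq _ _ _ (fun x => x.1)).
(* A level above all of [s] lets the new vertex decide the colours; the component [1] makes them the
   values of [pattern] itself. *)
exists (n, 1); first by apply/negP => /lt_n; rewrite ltnn.
move=> [j h] sa /=; rewrite (lt_n _ sa) invg1 mulg1 perm1; exact: nP.
Qed.

End Model.

(** * The complement for odd [m] *)

Lemma odd_split (m : nat) (V : countType) (R : ecgraph m V) (x0 : 'I_m) :
  extension_property R -> odd m -> splits_over (AutStar R) (Aut R).
Proof.
move=> ext m_odd; have [f f_sym] := symmetric_connection m_odd.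
have [phi [[psi phiK psiK] phi_col]] :=
  back_and_forth (model_extension x0 f_sym) ext.
have TK p : cancel (translate (m := m) p) (translate p^-1).
  by case=> n g; rewrite /translate /= mulgK.
have TVK p : cancel (translate p^-1) (translate (m := m) p).
  by case=> n g; rewrite /translate /= mulgKV.
have sK p : cancel (phi \o translate p \o psi) (phi \o translate p^-1 \o psi).
  by move=> v /=; rewrite phiK TK psiK.
have sVK p : cancel (phi \o translate p^-1 \o psi) (phi \o translate p \o psi).
  by move=> v /=; rewrite phiK TVK psiK.
(* Translations conjugated by [phi] give a homomorphic section of the action on colours; its range
   is the complement. *)
pose sec p : vperm V := VPerm (sK p) (sVK p).
have sec1 : sec 1 = 1.
  by apply: vperm_eq => v /=; rewrite /translate mulg1 -surjective_pairing psiK.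
have secM p q : sec p * sec q = sec (p * q).
  by apply: vperm_eq => v /=; rewrite phiK /translate /= mulgA.
have secV p : (sec p)^-1 = sec p^-1.
  exact: vperm_eq.
have sec_col p u v : u <> v -> R (sec p u) (sec p v) = p (R u v).
  move=> uv; have puv : psi u <> psi v by move=> /(can_inj psiK).
  rewrite /= phi_col ?model_translate; last by move=> /(can_inj (TK p)).
  by rewrite -(phi_col _ _ puv) !psiK.
exists (range sec); split.
- split=> [|g h]; first by apply/mem_set; exists 1.
  move=> /set_mem[p _ <-] /set_mem[q _ <-].
  by apply/mem_set; exists (p * q^-1); rewrite // secV secM.
- by move=> _ [p _ <-]; exists p => u v; apply: sec_col.
- apply/seteqP; split=> [_ [[p _ <-] pA] /=|_ ->].
    (* Every colour occurs on an edge, so a colour-preserving [sec p] forces [p] to fix all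
       colours. *)
    suff -> : p = 1 by [].
    apply/permP => i; rewrite perm1.
    have [u [v [uv <-]]] := edge_of_colour i ext.
    by rewrite -sec_col // pA.
  split; first by exists 1.
  by move=> u v.
- apply/seteqP; split=> [_ [_ [p _ <-] [n nA <-]]|h [p hp]].
    exists p => u v uv /=; rewrite nA; first exact: sec_col.
    by move=> /(can_inj (sK p)).
  exists (sec p); first by exists p.
  exists ((sec p)^-1 * h); last by rewrite mulKVg.
  move=> u v uv; rewrite secV /=.
  have ne : sec p^-1 u <> sec p^-1 v by move=> /(can_inj (sK p^-1)).
  by rewrite hp // sec_col // permKV.
Qed.

Theorem theorem1 (m : nat) (V : countType) (R : ecgraph m V) :
  2 <= m ->
  universal R ->
  homogeneous R ->
  (splits_over (AutStar R) (Aut R) <-> odd m).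
Proof.
move=> m_ge2 univ hom; have x0 : 'I_m := Ordinal (ltnW m_ge2).
have ext := universal_homogeneous_extension x0 univ hom.
split; last exact: odd_split.
by move=> split; apply/negPn/negP => /(even_not_split x0 ext).
Qed.
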